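(* Let $G=(V,E)$ be a finite simple graph and let $\Omega$ be the set of locally injective functions $g:V\to\mathbb{R}$. Let $(\Omega,\mathcal{A},m)$ be a probability space on $\Omega$ such that for every $v\in V$ the map $g\mapsto i_g(v)$ is measurable, and define the curvature $K(v)=\mathrm{E}[i_g(v)]=\int_\Omega i_g(v)\,dm(g)$. Then $$\chi(G)=\sum_{v\in V}K(v).$$
   Context: A finite simple graph $G=(V,E)$ has Whitney complex consisting of the (non-empty) vertex sets of complete subgraphs of $G$; its Euler characteristic is $\chi(G)=\sum_{x}(-1)^{|x|-1}$, the sum over all elements $x$ of the Whitney complex (the empty graph has $\chi=0$). A function $g:V\to\mathbb{R}$ is locally injective if $g(v)\neq g(w)$ whenever $(v,w)\in E$. The unit sphere $S(v)$ is the subgraph generated (induced) by all vertices adjacent to $v$. For a locally injective $g$, $S^-_g(v)$ is the subgraph generated by $\{w\in S(v): g(w)<g(v)\}$, and the Poincaré–Hopf index is $i_g(v)=1-\chi(S^-_g(v))$. *)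

(* Defs.v *)
From HB Require Import structures.
From mathcomp Require Import all_boot all_order all_algebra.
From mathcomp Require Import all_classical all_reals all_analysis.

Set Implicit Arguments.
Unset Strict Implicit.
Unset Printing Implicit Defensive.

Import Order.TTheory GRing.Theory Num.Theory.

Local Open Scope classical_set_scope.
Local Open Scope ring_scope.

Record sgraph := SGraph {
  vertex :> finType;
  edge : rel vertex;
  edge_sym : symmetric edge;
  edge_irr : irreflexive edge }.

Section Graph.
Variable G : sgraph.

Definition complete_on (x : {set G}) : bool :=
  [forall v in x, forall w in x, (v != w) ==> edge v w].

Definition whitney : {set {set G}} :=
  [set x : {set G} | (x != finset.set0) && complete_on x]%SET.

(* The truncated predecessor is harmless: elements of [whitney] are nonempty. *)
Definition euler_char : int := \sum_(x in whitney) (-1) ^+ (#|x|.-1).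

Section Generated.
Variable W : {set G}.
Let V := {w : G | w \in W}.
Let e : rel V := fun v w => edge (val v) (val w).

Fact generated_sym : symmetric e.
Proof. by move=> v w; rewrite /e edge_sym. Qed.

Fact generated_irr : irreflexive e.
Proof. by move=> v; rewrite /e edge_irr. Qed.

Definition generated : sgraph := SGraph generated_sym generated_irr.

End Generated.

(* The vertex set of the unit sphere S(v). *)
Definition sphere (v : G) : {set G} := [set w | edge v w]%SET.

Definition locally_injective (R : realType) (g : G -> R) : Prop :=
  forall v w : G, edge v w -> g v <> g w.

Definition lower_sphere (R : realType) (g : G -> R) (v : G) : sgraph :=
  generated [set w in sphere v | g w < g v]%SET.

End Graph.

Definition ph_index (R : realType) (G : sgraph) (g : G -> R) (v : G) : int :=
  1 - euler_char (lower_sphere g v).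

(* The sample space Omega. *)
Record locinj (R : realType) (G : sgraph) := LocInj {
  locinj_fun :> G -> R;
  locinjP : locally_injective locinj_fun }.

Section LocInjPointed.
Variables (R : realType) (G : sgraph).

Fact enum_rank_locinj :
  locally_injective (fun v : G => (enum_rank v : nat)%:R : R).
Proof.
move=> v w evw /eqP; rewrite eqr_nat => /eqP /ord_inj /enum_rank_inj vw.
by move: evw; rewrite vw edge_irr.
Qed.

(* Measurable types are pointed in the library; Omega is never empty. *)
HB.instance Definition _ := gen_eqMixin (locinj R G).
HB.instance Definition _ := gen_choiceMixin (locinj R G).
HB.instance Definition _ := isPointed.Build (locinj R G)
  (LocInj enum_rank_locinj).

End LocInjPointed.

(* [g_sigma_algebraType A] is Omega with the sigma-algebra generated by [A],
   which is [A] itself when [A] is a sigma-algebra. *)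
Definition curvature (R : realType) (G : sgraph)
    (A : set (set (locinj R G)))
    (m : probability (g_sigma_algebraType A) R) (v : G) : \bar R :=
  'E_m[fun g : locinj R G => (ph_index g v)%:~R]%E.

(* Main.v *)
(** A locally injective [g] is injective on each complete vertex set, so every
    simplex [x] has a unique vertex [v] where [g] is maximal, and [x] is [v]
    together with a possibly empty complete set of [S^-_g(v)].  Grouping the
    simplices by this top vertex gives the Poincare-Hopf identity
    [chi(G) = \sum_v i_g(v)] for every [g]; since the indices are bounded, the
    expectation can be exchanged with the sum. *)

Require Import Defs.
From HB Require Import structures.
From mathcomp Require Import all_boot all_order all_algebra.
From mathcomp Require Import all_classical all_reals all_analysis.
Set Implicit Arguments.
Unset Strict Implicit.
Unset Printing Implicit Defensive.
Import Order.TTheory GRing.Theory Num.Theory.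
Local Open Scope classical_set_scope.
Local Open Scope ring_scope.

(* The empty complete set of the lower sphere accounts for the simplex [{v}],
   hence for the summand [1] of the index. *)
Lemma sum_whitney_apex (R : realType) (G : sgraph) (g : G -> R) (v : G) :
  \sum_(x in whitney G | (v \in x) && [forall w in x, (w != v) ==> (g w < g v)])
    (-1) ^+ (#|x|.-1) = ph_index g v.
Proof.
set L := lower_sphere g v.
(* [h] cones a vertex set of the lower sphere off with apex [v]; [h'] removes the apex again. *)
pose h (y : {set L}) : {set G} := (v |: [set val w | w in y])%SET.
pose h' (x : {set G}) : {set L} := [set w : L | val w \in x]%SET.
have lowerP (w : L) : edge v (val w) && (g (val w) < g v).
  by have := valP w; rewrite !inE.
have vNlower (w : L) : (val w == v) = false.
  by apply/negP => /eqP wv; have := lowerP w; rewrite wv edge_irr.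
have vN (y : {set L}) : v \notin [set val w | w in y]%SET.
  by apply/negP => /imsetP[w _ /esym/eqP]; rewrite vNlower.
have h'K y : h' (h y) = y.
  apply/setP => w; rewrite !inE vNlower /=.
  by rewrite mem_imset //; exact: val_inj.
rewrite (reindex_onto h h') /=; last first.
  move=> x /andP[]; rewrite inE => /andP[_ /forall_inP cx].
  move=> /andP[vx /forall_inP tx].
  apply/setP => w; rewrite !inE; have [->//|wv /=] := eqVneq w v.
  apply/imsetP/idP => [[u + ->]|wx]; first by rewrite inE.
  have wL : w \in [set w in sphere v | g w < g v]%SET.
    rewrite !inE (implyP (tx w wx) wv) andbT.
    by have /forall_inP/(_ w wx) := cx v vx; rewrite eq_sym wv.
  by exists (Sub w wL : L); rewrite ?inE SubK.
(* Every vertex of [L] is adjacent to [v] and lies below it, so the cone [h y] is a simplex with top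
   [v] exactly when [y] is complete, with [y] empty allowed. *)
rewrite (eq_bigl (@complete_on L)); last first.
  move=> y; rewrite h'K eqxx andbT inE.
  have -> : h y != finset.set0 by apply/set0Pn; exists v; rewrite !inE eqxx.
  rewrite {2}/h setU11 /=.
  have -> : [forall w in h y, (w != v) ==> (g w < g v)].
    apply/forall_inP => w; rewrite !inE => /orP[->//|/imsetP[u _ ->]].
    by have /andP[_ ->] := lowerP u; rewrite implybT.
  rewrite andbT; apply/idP/idP => /forall_inP cy; apply/forall_inP => a ay.
    apply/forall_inP => b yb.
    have /forall_inP/(_ (val b)) := cy (val a) (setU1r _ (imset_f _ ay)).
    by move=> /(_ (setU1r _ (imset_f _ yb))); rewrite (inj_eq val_inj).
  apply/forall_inP => b; move: ay; rewrite !inE.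
  move=> /orP[/eqP->|/imsetP[a' ya ->]] /orP[/eqP->|/imsetP[b' yb ->]].
  - by rewrite eqxx.
  - by have /andP[-> _] := lowerP b'; rewrite implybT.
  - by rewrite edge_sym; have /andP[-> _] := lowerP a'; rewrite implybT.
  - by have /forall_inP/(_ b' yb) := cy a' ya; rewrite (inj_eq val_inj).
(* The apex cancels the predecessor: a nonempty [y] enters with the sign opposite to its own in
   [euler_char L], whence the minus in the index. *)
have card_h y : #|h y|.-1 = #|y|.
  by rewrite cardsU1 vN card_imset //; exact: val_inj.
under eq_bigr => y _ do rewrite card_h.
rewrite (bigD1 finset.set0) /=; last first.
  by apply/forall_inP => a; rewrite inE.
rewrite cards0 expr0 /ph_index; congr (_ + _).
rewrite /euler_char -sumrN; apply: eq_big => [y|y /andP[_]].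
  by rewrite inE andbC.
by rewrite -card_gt0; case: #|y| => // n _; rewrite exprS mulN1r.
Qed.

Theorem poincare_hopf (R : realType) (G : sgraph) (g : G -> R) :
  locally_injective g -> euler_char G = \sum_(v : G) ph_index g v.
Proof.
move=> inj_g; under eq_bigr => v _ do rewrite -sum_whitney_apex.
rewrite (exchange_big_dep (fun x => x \in whitney G)) /=; last first.
  by move=> v x _ /andP[].
apply: eq_bigr => x xW.
have := xW; rewrite inE => /andP[/set0Pn[v0 v0x] /forall_inP cx].
have [v vx  vmax] := @arg_maxP _ _ _ v0 (mem x) g v0x.
have {}vmax w : w \in x -> g w <= g v by exact: vmax.
rewrite (big_pred1 v) // => u.
(* A second apex [u] would give [g v < g u], against maximality of [v]. Conversely, local
   injectivity makes the maximum strict, as the vertices of [x] are pairwise adjacent. *)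
apply/andP/eqP => [[_ /andP[ux /forall_inP tu]]|->{u}].
  apply/eqP/negPn/negP; rewrite eq_sym => vu.
  by have := implyP (tu v vx) vu; rewrite ltNge vmax.
split; first by rewrite inE in xW.
apply/andP; split=> //; apply/forall_inP => w wx; apply/implyP => wv.
rewrite lt_neqAle vmax // andbT; apply/eqP; apply: inj_g.
by have /forall_inP/(_ v vx) := cx w wx; rewrite wv.
Qed.

(** By the apex sum, the index is a sum of signs over distinct vertex sets. The bound is uniform in
    [g], which gives integrability under a probability measure. *)
Lemma normr_ph_index_le (R : realType) (G : sgraph) (g : G -> R) (v : G) :
  `|ph_index g v| <= (2 ^ #|G|)%:Z.
Proof.
rewrite -sum_whitney_apex (le_trans (ler_norm_sum _ _ _)) //.
under eq_bigr => x _ do rewrite normrX normrN1 expr1n.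
rewrite sumr_const -[_ *+ _]/(_%:R) natz lez_nat.
by rewrite -cardsT -card_powerset powersetT cardsT max_card.
Qed.

Theorem mainTheorem1 (R : realType) (G : sgraph)
    (A : set (set (locinj R G))) (hA : sigma_algebra setT A)
    (m : probability (g_sigma_algebraType A) R)
    (hmeas : forall v : G,
      measurable_fun [set: g_sigma_algebraType A]
        (fun g : g_sigma_algebraType A =>
           (ph_index (g : locinj R G) v)%:~R : R)) :
  (((euler_char G)%:~R : R)%:E = \sum_(v : G) curvature m v)%E.
Proof.
have int_index v : m.-integrable setT
    (EFin \o (fun g : g_sigma_algebraType A =>
                (ph_index (g : locinj R G) v)%:~R : R)).
  apply: measurable_bounded_integrable => //.
    exact: le_lt_trans (probability_le1 m measurableT) (ltry 1).
  exists (2 ^ #|G|)%:R; split; first exact: num_real.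
  move=> M /ltW leM g _; apply: le_trans leM => /=.
  by rewrite -intr_norm -[leRHS]/((_%:Z)%:~R) ler_int normr_ph_index_le.
rewrite /curvature; under eq_bigr => v _ do rewrite unlock.
rewrite -integral_sum //=.
(* For each [g] the integrand is now the constant [euler_char G], to be multiplied by the total mass
   1. *)
under eq_integral => g _ do
  rewrite sumEFin -rmorph_sum -(poincare_hopf (@locinjP _ _ g)).
rewrite integral_cst //.
exact/esym/(etrans _ (mule1 _))/(congr1 _ (probability_setT m)).
Qed.
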